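(* Let $p,d$ be integers with $2\le p\le d$, and define $$b_d:=2^{1/4}d^{3/4}\sqrt{1-\frac{4}{2\sqrt2\,d^{3/2}-d}}\quad(d\ge2),\qquad c_d:=\left(\frac{d^2}{4}-1\right)^{1/2}\sqrt{1-\frac{8}{d^2-2d-4}}\quad(d\ge5),$$ with the convention $\max(b_d,c_d)=b_d$ when $2\le d\le4$. Let $\tilde k_{ORF}$ be the orthogonal-random-features approximate kernel built from $p$ random vectors in $\mathbb{R}^d$. Then for all $x,y\in\mathbb{R}^d$ such that $z:=\|x-y\|\in[0,\max(b_d,c_d)]$, $$e^{-z^2/2}\le\mathbb{E}[\tilde k_{ORF}(x,y)]\le e^{-z^2/(2d)}.$$ Moreover, the upper bound $\mathbb{E}[\tilde k_{ORF}(x,y)]\le e^{-z^2/(2d)}$ is valid for all $x,y$ with $z=\|x-y\|$ up to the second positive zero of the normalized Bessel function $j_{d/2-1}$.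
   Context: Let $O$ be a random $d\times d$ orthogonal matrix distributed according to the Haar probability measure on the orthogonal group $O(d)$, and let $w_1,\dots,w_p\in\mathbb{R}^d$ be $p$ distinct columns of $O$ (say the first $p$). For $x\in\mathbb{R}^d$ put $$\tilde\phi_{ORF}(x):=\frac1{\sqrt p}\big(\sin(w_1^\top x),\dots,\sin(w_p^\top x),\cos(w_1^\top x),\dots,\cos(w_p^\top x)\big)^\top\in\mathbb{R}^{2p}.$$ The ORF approximate kernel is $$\tilde k_{ORF}(x,y):=\tilde\phi_{ORF}(x)^\top\tilde\phi_{ORF}(y)=\frac1p\sum_{j=1}^p\cos(w_j^\top(x-y)).$$ $\|\cdot\|$ is the Euclidean norm, and expectation is over the randomness of $O$. The normalized Bessel function of the first kind is $$j_{d/2-1}(z)=\sum_{n\ge 0}\frac{(-1)^n\,\Gamma(d/2)}{n!\,\Gamma(n+d/2)}\left(\frac z2\right)^{2n};$$ it has infinitely many positive zeros, all simple, forming a sequence increasing to infinity. *)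

(* Defs.v *)
From HB Require Import structures.
From mathcomp Require Import all_boot all_order all_algebra.
From mathcomp Require Import all_classical all_reals all_analysis.
Set Implicit Arguments.
Unset Strict Implicit.
Unset Printing Implicit Defensive.
Import Order.TTheory GRing.Theory Num.Theory.
Import numFieldNormedType.Exports.
Local Open Scope classical_set_scope.
Local Open Scope ring_scope.

(* The library's norm `|x| on 'cV[R]_d is the sup norm, so the Euclidean norm
   is spelled out. *)
Definition euclid_norm (R : realType) (d : nat) (x : 'cV[R]_d) : R :=
  Num.sqrt (\sum_(i < d) x i 0 ^+ 2).

Definition orthogonal_group (R : realType) (d : nat) : set 'M[R]_d :=
  [set Q | Q^T *m Q = 1%:M].

(* d x d matrices with the Borel sigma-algebra of the entrywise topology. *)
Definition borel_matrix (R : realType) (d : nat) :=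
  g_sigma_algebraType (@open 'M[R]_d).

(* The Haar probability measure on O(d), carried as a Borel measure on the
   ambient matrix space: mass one on O(d), invariant under left translations
   by O(d). *)
Definition is_haar_orthogonal (R : realType) (d : nat)
    (mu : set (borel_matrix R d) -> \bar R) : Prop :=
  mu (@orthogonal_group R d) = 1%E /\
  forall (Q : 'M[R]_d) (A : set (borel_matrix R d)),
    @orthogonal_group R d Q -> measurable A ->
    mu [set M : 'M[R]_d | A (Q *m M)] = mu A.

(* The column j of W is the random vector w_j; the first block of the feature
   vector holds the sines, the second one the cosines. *)
Definition orf_feature (R : realType) (p d : nat) (W : 'M[R]_(d, p))
    (x : 'cV[R]_d) : 'cV[R]_(p + p) :=
  (Num.sqrt p%:R)^-1 *:
    col_mx (\col_(j < p) sin (((col j W)^T *m x) 0 0))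
           (\col_(j < p) cos (((col j W)^T *m x) 0 0)).

Definition orf_kernel (R : realType) (p d : nat) (W : 'M[R]_(d, p))
    (x y : 'cV[R]_d) : R :=
  ((orf_feature W x)^T *m orf_feature W y) 0 0.

Definition Gamma (R : realType) (x : R) : R :=
  \int[@lebesgue_measure R]_(t in `]0, +oo[) (t `^ (x - 1) * expR (- t)).

(* The normalized Bessel function of the first kind j_{d/2-1}. *)
Definition bessel_j (R : realType) (d : nat) (z : R) : R :=
  limn (series (fun n : nat =>
    (-1) ^+ n * Gamma (d%:R / 2 : R) / (n`!%:R * Gamma (n%:R + d%:R / 2 : R))
    * (z / 2) ^+ (2 * n))).

(* s is a positive zero of f with exactly one positive zero below it; as the
   positive zeros of j_{d/2-1} are simple, multiplicities play no role. *)
Definition is_second_positive_zero (R : realType) (f : R -> R) (s : R) : Prop :=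
  [/\ 0 < s, f s = 0 &
      exists2 r, (0 < r < s /\ f r = 0) &
        forall t, 0 < t < s -> f t = 0 -> t = r].

Definition b_radius (R : realType) (d : nat) : R :=
  2 `^ (1 / 4) * d%:R `^ (3 / 4) *
  Num.sqrt (1 - 4 / (2 * Num.sqrt 2 * d%:R `^ (3 / 2) - d%:R)).

Definition c_radius (R : realType) (d : nat) : R :=
  (d%:R ^+ 2 / 4 - 1) `^ (1 / 2) *
  Num.sqrt (1 - 8 / (d%:R ^+ 2 - 2 * d%:R - 4)).

(* max (b_d, c_d), where c_d is only meaningful for d >= 5. *)
Definition max_radius (R : realType) (d : nat) : R :=
  if (d <= 4)%N then b_radius R d else Num.max (b_radius R d) (c_radius R d).

(* Main.v *)
Require Import Defs.
From HB Require Import structures.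
From mathcomp Require Import all_boot all_order all_algebra.
From mathcomp Require Import all_classical all_reals all_analysis.
From mathcomp Require Import measurable_realfun zify ring lra.
Import Order.TTheory GRing.Theory Num.Theory.
Import numFieldNormedType.Exports.
Local Open Scope classical_set_scope.
Local Open Scope ring_scope.

(* By left invariance the moments of a column w of O are
   E (w.v)^(2n) = |v|^(2n) C_n; comparing the coefficients of b^2 in
   E (w_0 + b w_1)^(2n) = (1 + b^2)^n C_n and summing over the coordinates of the
   unit vector w gives a recursion for C_n, so that the expected kernel is F(z^2)
   with F(z^2) = j_{d/2-1}(z).  As a function of s = z^2, F solves
   L F := 4 s F'' + 2 d F' + F = 0, and a Sturm comparison shows that, as long as
   F >= 0, F / G is nonincreasing when L G >= 0 and nondecreasing when L G <= 0.
   The upper bound up to the first zero is the case G = exp(-s/(2d)), and G = 1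
   shows that F decreases, hence stays nonpositive between its first two zeros.
   For the lower bound take G = (1 - s/r) exp(-d s/(4r)), for which L G <= 0 on
   [0, r] as soon as r <= d^2/4 + 2d; moreover G >= exp(-s/2) for
   s <= r (1 - 4/(2r - d)).  Both r = sqrt 2 d^(3/2) (by AM-GM) and r = d^2/4 - 1
   are admissible, and they give b_d and c_d. *)

(** * Sturm comparison *)

Lemma is_derive_continuous {R : realType} (f f' : R -> R) :
  (forall x : R, is_derive x 1 f (f' x)) -> continuous f.
Proof.
move=> df x; apply: differentiable_continuous; apply/derivable1_diffP.
exact: ex_derive.
Qed.

Section first_order_comparison.
Context {R : realType} (d : nat) (W W' : R -> R) (T : R).
Hypothesis d_gt0 : (0 < d)%N.
Hypothesis dW : forall s : R, is_derive s 1 W (W' s).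

(* [z |-> z ^+ d * W (z ^+ 2)] vanishes at 0 and has the sign of
   [2 s W' + d W] as derivative. *)
Let mvt (s : R) : 0 < s -> exists2 c, 0 < c < Num.sqrt s &
  Num.sqrt s ^+ d * W s =
  c ^+ d.-1 * (2 * c ^+ 2 * W' (c ^+ 2) + d%:R * W (c ^+ 2)) * Num.sqrt s.
Proof.
move=> s0; pose u (z : R) := z ^+ d * W (z ^+ 2).
pose u' (z : R) := z ^+ d.-1 * (2 * z ^+ 2 * W' (z ^+ 2) + d%:R * W (z ^+ 2)).
have du (z : R) : is_derive z 1 u (u' z).
  have dsq : is_derive z 1 (fun z : R => z ^+ 2) (2 * z).
    apply: is_derive_eq; rewrite /GRing.scale /=; ring.
  have dWsq : is_derive z 1 (fun z : R => W (z ^+ 2)) (W' (z ^+ 2) * (2 * z)).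
    exact: (@is_derive1_comp _ W (fun z => z ^+ 2)).
  have dX : is_derive z 1 (fun z : R => z ^+ d) (d%:R * z ^+ d.-1).
    have := is_deriveX d (is_derive_id z (1 : R)).
    by rewrite exprfctE /GRing.scale /= mulr1.
  apply: (is_derive_eq (is_deriveM dX dWsq)); rewrite /u' /GRing.scale /=.
  by rewrite -{1}(prednK d_gt0) exprS; ring.
have z0 : 0 < Num.sqrt s by rewrite sqrtr_gt0.
have [|c cI] := MVT z0 (fun z _ => du z).
  exact/continuous_subspaceT/(is_derive_continuous _ _ du).
rewrite /u sqr_sqrtr ?(ltW s0)// expr0n gtn_eqF// mul0r !subr0 => ->.
by exists c.
Qed.

(** The integrating factor s^(d/2 - 1) turns [2 s W' + d W] into twice the derivative of s^(d/2) W.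
    The substitution s = z^2 in [mvt] makes this power an integer one for every [d], and the product
    vanishes at 0, so its sign is that of its derivative. *)
Lemma first_order_le0 : (forall s : R, 0 < s < T -> 2 * s * W' s + d%:R * W s <= 0) ->
  forall s : R, 0 < s <= T -> W s <= 0.
Proof.
move=> h s /andP[s0 sT]; have [c /andP[c0 cs] e] := mvt s s0.
have z0 : 0 < Num.sqrt s by rewrite sqrtr_gt0.
rewrite -(pmulr_rle0 _ (exprn_gt0 d z0)) e pmulr_lle0// pmulr_rle0 ?exprn_gt0//.
apply: h; rewrite exprn_gt0//= (lt_le_trans _ sT)//.
by rewrite -(sqr_sqrtr (ltW s0)) ltrXn2r// ?nnegrE ltW.
Qed.

End first_order_comparison.

Section sturm_comparison.
Context {R : realType} (d : nat) (F F' F'' G G' G'' : R -> R) (T : R).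
Hypothesis d_gt0 : (0 < d)%N.
Hypothesis dF : forall s : R, is_derive s 1 F (F' s).
Hypothesis dF' : forall s : R, is_derive s 1 F' (F'' s).
Hypothesis odeF : forall s : R, 4 * s * F'' s + 2 * d%:R * F' s + F s = 0.
Hypothesis dG : forall s : R, is_derive s 1 G (G' s).
Hypothesis dG' : forall s : R, is_derive s 1 G' (G'' s).
Let LG s := 4 * s * G'' s + 2 * d%:R * G' s + G s.

(** The Wronskian W = F' G - F G' satisfies 2 s W' + d W = - F (L G) / 2, since L F = 0 eliminates
    F''. *)
Lemma sturm_wronskian_le0 : (forall s : R, 0 < s < T -> 0 <= F s * LG s) ->
  forall s : R, 0 < s <= T -> F' s * G s - F s * G' s <= 0.
Proof.
move=> h; pose W s := F' s * G s - F s * G' s.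
pose W' s := F'' s * G s - F s * G'' s.
apply: (@first_order_le0 _ d W W') => // [s|s sT].
  apply: (is_derive_eq (is_deriveB (is_deriveM (dF' s) (dG s))
    (is_deriveM (dF s) (dG' s)))); rewrite /W' /GRing.scale /=; ring.
rewrite /W /W'; have := h s sT; rewrite /LG => hs.
have e : F'' s * s *+ 4 = - (F s + 2 * d%:R * F' s).
  by have := odeF s; move=> ?; lra.
suff -> : 2 * s * (F'' s * G s - F s * G'' s) + d%:R * (F' s * G s - F s * G' s)
  = - (F s * (4 * s * G'' s + 2 * d%:R * G' s + G s)) / 2 by lra.
have -> : 2 * s * (F'' s * G s - F s * G'' s) =
   F'' s * s *+ 4 * G s / 2 - 2 * s * F s * G'' s by field.
by rewrite e; field.
Qed.

(** The derivative of F / G is the Wronskian over G^2, so F / G stays below its value at 0. The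
    constant [k] may be negative: applied to - F with k = -1, this is a lower bound for F. *)
Lemma sturm_le (k : R) : (forall s : R, 0 < s < T -> 0 <= F s * LG s) ->
  (forall s : R, 0 <= s <= T -> 0 < G s) -> F 0 <= k * G 0 ->
  forall s : R, 0 <= s <= T -> F s <= k * G s.
Proof.
move=> h G0 FG0 s /andP[s0 sT].
have [->//|sn0] := eqVneq s 0.
have {sn0}s0 : 0 < s by rewrite lt_neqAle eq_sym sn0.
pose q s := F s / G s.
pose q' s := (F' s * G s - F s * G' s) / G s ^+ 2.
have dq (x : R) : 0 <= x <= T -> is_derive x 1 q (q' x).
  move=> /G0 Gx; have dV := is_deriveV (lt0r_neq0 Gx) (dG x).
  apply: (is_derive_eq (is_deriveM (dF x) dV)).
  rewrite /q' /GRing.scale /=; field.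
  exact: lt0r_neq0.
have [||c] := @MVT R q q' 0 s s0.
- move=> x; rewrite in_itv/= => /andP[x0 xs]; apply: dq.
  by rewrite (ltW x0) (le_trans (ltW xs)).
- apply: continuous_in_subspaceT => x; rewrite inE/= in_itv/= => /andP[x0 xs].
  apply: differentiable_continuous; apply/derivable1_diffP.
  by have [] := dq x; rewrite ?x0 ?(le_trans xs).
rewrite in_itv/= => /andP[c0 cs] e.
have le0 : q s - q 0 <= 0.
  rewrite e mulr_le0_ge0// ?subr0 ?(ltW s0)//.
  rewrite /q' mulr_le0_ge0 ?invr_ge0 ?sqr_ge0//.
  by apply: sturm_wronskian_le0; rewrite // c0 (le_trans (ltW cs)).
have q0 : q 0 <= k.
  by rewrite /q ler_pdivrMr// G0// lexx (le_trans (ltW s0)).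
have : q s <= k by lra.
by rewrite /q ler_pdivrMr// G0// sT ltW.
Qed.

End sturm_comparison.

(** * The Bessel series *)

Section entire_series.
Context {R : realType}.
Implicit Types (c : nat -> R).

(** Stepwise form of |c_n| <= |c_0| / n!, chosen because the formal derivative [pseries_diffs]
    inherits it: all termwise derivatives then converge everywhere. *)
Definition factorial_decay c := forall n, n.+1%:R * `|c n.+1| <= `|c n|.

Lemma factorial_decay_diffs c : factorial_decay c -> factorial_decay (pseries_diffs c).
Proof.
move=> hc n; rewrite /pseries_diffs !normrM !normr_nat.
by rewrite ler_pM2l ?ltr0n.
Qed.

Lemma factorial_decay_le c n : factorial_decay c -> `|c n| <= `|c 0%N| / n`!%:R.
Proof.
move=> hc; elim: n => [|n ih]; first by rewrite fact0 divr1.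
rewrite ler_pdivlMr ?ltr0n ?fact_gt0// factS natrM mulrCA.
apply: le_trans (_ : `|c n| * n`!%:R <= _); last first.
  by rewrite -ler_pdivlMr// ltr0n fact_gt0.
by rewrite mulrA ler_wpM2r// mulrC hc.
Qed.

Lemma factorial_decay_cvg c x : factorial_decay c -> cvgn (pseries c x).
Proof.
move=> hc; apply: normed_cvg.
apply: (@series_le_cvg _ _ (`|c 0%N| *: exp_coeff `|x|)) => [n|n|n|] //=.
- by rewrite /exp_coeff /= -[X in 0 <= X]/(`|c 0%N| * (`|x| ^+ n / n`!%:R)) mulr_ge0// divr_ge0.
- rewrite -[X in _ <= X]/(`|c 0%N| * (`|x| ^+ n / n`!%:R)) normrM normrX.
  by rewrite mulrA mulrAC ler_wpM2r// factorial_decay_le.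
- exact/is_cvg_seriesZ/is_cvg_series_exp_coeff.
Qed.

Lemma is_derive_pseries c (x : R) : factorial_decay c ->
  is_derive x 1 (fun x => limn (pseries c x)) (limn (pseries (pseries_diffs c) x)).
Proof.
(* Termwise differentiation at [x] asks for convergence of the series and of its first two formal
   derivatives at a point of larger modulus; [|x| + 1] is one. *)
move=> hc; apply: (@pseries_snd_diffs _ _ (`|x| + 1)).
- exact: factorial_decay_cvg.
- exact/factorial_decay_cvg/factorial_decay_diffs.
- exact/factorial_decay_cvg/factorial_decay_diffs/factorial_decay_diffs.
- by rewrite [X in _ < X]ger0_norm ?addr_ge0// ltrDl.
Qed.

End entire_series.

Section bessel_series.
Context {R : realType} (d : nat).
Hypothesis d_gt0 : (0 < d)%N.

(** As Gamma(n + d/2) / Gamma(d/2) is the product of the (d + 2k) / 2 for k < n, this is the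
    coefficient of z^(2n) in j_{d/2-1}(z), written without Gamma. *)
Definition bessel_coef n : R :=
  (-1) ^+ n / (2 ^+ n * n`!%:R * \prod_(k < n) (d + 2 * k)%:R).

(* [bessel_series (z ^+ 2)] is the normalized Bessel function [j_{d/2-1} z]. *)
Definition bessel_series (s : R) : R := limn (pseries bessel_coef s).
Definition bessel_series' (s : R) : R :=
  limn (pseries (pseries_diffs bessel_coef) s).
Definition bessel_series'' (s : R) : R :=
  limn (pseries (pseries_diffs (pseries_diffs bessel_coef)) s).

Let dk_gt0 k : 0 < (d + 2 * k)%:R :> R.
Proof. by rewrite ltr0n addn_gt0 d_gt0. Qed.

Lemma bessel_coefS n :
  bessel_coef n.+1 * (2 * n.+1%:R * (d + 2 * n)%:R) = - bessel_coef n.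
Proof.
rewrite /bessel_coef big_ord_recr/= factS !exprS natrM.
have p0 : \prod_(k < n) (d + 2 * k)%:R != 0 :> R.
  by apply/prodf_neq0 => k _; rewrite gt_eqF.
have := dk_gt0 n; move: (d + 2 * n)%N => m m0.
field; rewrite p0 ?gt_eqF ?ltr0n ?fact_gt0//.
by rewrite -(ltr0n R).
Qed.

Lemma bessel_coef_decay : factorial_decay bessel_coef.
Proof.
move=> n; rewrite -(normrN (bessel_coef n)) -bessel_coefS !normrM !normr_nat.
rewrite mulrC ler_wpM2l// mulrAC ler_peMl ?ler0n//.
by rewrite -natrM ler1n muln_gt0/= addn_gt0 d_gt0.
Qed.

Lemma is_derive_bessel_series (s : R) : is_derive s 1 bessel_series (bessel_series' s).
Proof. exact/is_derive_pseries/bessel_coef_decay. Qed.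

Lemma is_derive_bessel_series' (s : R) :
  is_derive s 1 bessel_series' (bessel_series'' s).
Proof. exact/is_derive_pseries/factorial_decay_diffs/bessel_coef_decay. Qed.

Lemma bessel_series0 : bessel_series 0 = 1.
Proof.
apply/cvg_lim => //; rewrite -cvg_shiftS; apply: cvg_near_cst.
apply: nearW => n; rewrite /pseries /series /= big_nat_recl//=.
rewrite /bessel_coef big_ord0 !expr0 fact0 !mulr1 divr1 big1 ?addr0// => i _.
by rewrite expr0n mulr0.
Qed.

(** Coefficientwise the equation is [bessel_coefS], that is 2 (n+1) (d + 2n) c_(n+1) + c_n = 0. *)
Lemma bessel_series_ode (s : R) :
  4 * s * bessel_series'' s + 2 * d%:R * bessel_series' s + bessel_series s = 0.
Proof.
have dc := bessel_coef_decay; have dc' := factorial_decay_diffs _ dc.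
have dc'' := factorial_decay_diffs _ dc'.
have c0 := factorial_decay_cvg _ s dc; have c1 := factorial_decay_cvg _ s dc'.
(* In this form the term i of the second derivative carries s^(i-1) and a factor i; multiplied by s
   it aligns with the other two series, so that the partial sums cancel term by term. *)
have c2 := pseries_diffs_equiv (factorial_decay_cvg _ s dc'').
set l := LHS; suff lim0 : (fun=> 0 : R) @ \oo --> l.
  by rewrite -(cvg_lim (@Rhausdorff R) lim0) lim_cst.
apply: cvg_trans (cvgD (cvgD (cvgM (cvg_cst (4 * s : R)) c2)
  (cvgM (cvg_cst (2 * d%:R : R)) c1)) c0).
apply: near_eq_cvg; apply: nearW => n /=.
rewrite -[LHS]/(4 * s * series _ n + 2 * d%:R * series _ n + series _ n).
rewrite /series /= !mulr_sumr -!big_split/= big1// => i _.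
rewrite /pseries_diffs.
case: i => [|i].
  have := bessel_coefS 0; rewrite muln0 addn0 expr0 => h; nra.
have := bessel_coefS i.+1; rewrite exprS /= natrD natrM => h.
rewrite -[bessel_coef i.+1]opprK -h; ring.
Qed.

End bessel_series.

(** * Bounds on the Bessel series *)

Section bessel_series_bounds.
Context {R : realType} (d : nat).
Hypothesis d_gt0 : (0 < d)%N.
Notation F := (@bessel_series R d).
Notation F' := (@bessel_series' R d).

Let dF s := is_derive_bessel_series d d_gt0 s : is_derive s (1 : R) F (F' s).
Let dF' s := is_derive_bessel_series' d d_gt0 s :
  is_derive s (1 : R) F' (bessel_series'' d s).
Let odeF (s : R) := bessel_series_ode d d_gt0 s.

Lemma continuous_bessel_series : continuous F.
Proof. exact: (is_derive_continuous _ _ dF). Qed.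

Let is_derive_expRM (a s : R) :
  is_derive s 1 (fun s => expR (a * s)) (a * expR (a * s)).
Proof.
have := is_derive1_comp (is_derive_expR (a * s))
  (is_deriveM (is_derive_cst a s 1) (is_derive_id s (1 : R))).
by move/is_derive_eq; apply; rewrite /GRing.scale /= mulr1 mulr0 addr0 mulrC.
Qed.

(** The exponent a = -1/(2d) is the solution of 2 d a + 1 = 0, which leaves L G = 4 a^2 s G >= 0 for
    G = exp(a s). *)
Lemma bessel_series_le_expR (T : R) : (forall s, 0 < s < T -> 0 <= F s) ->
  forall s, 0 <= s <= T -> F s <= expR (- (s / (2 * d%:R))).
Proof.
move=> F0 s sT; pose a : R := - (2 * d%:R)^-1.
have d0 : (d%:R : R) != 0 by rewrite pnatr_eq0 -lt0n.
rewrite (_ : - _ = a * s); last by rewrite /a mulNr mulrC.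
have dG' (x : R) :
    is_derive x 1 (fun x => a * expR (a * x)) (a * (a * expR (a * x))).
  apply: (is_derive_eq (is_deriveZ a (is_derive_expRM a x))).
  by rewrite /GRing.scale.
rewrite -[leRHS]mul1r.
apply: (@sturm_le _ d F F' (bessel_series'' d) (fun s => expR (a * s)) _ _ T
  d_gt0 dF dF' odeF (is_derive_expRM a) dG') => // [x /andP[x0 xT]|x _|].
- rewrite mulr_ge0 ?F0 ?x0//.
  rewrite (_ : _ + _ = 4 * x * a ^+ 2 * expR (a * x)).
    by rewrite mulr_ge0 ?expR_ge0// mulr_ge0 ?sqr_ge0// mulr_ge0// ltW.
  by rewrite /a; field.
- exact: expR_gt0.
- by rewrite bessel_series0 mulr0 expR0 mulr1.
Qed.

(** Where F >= 0, the differential equation reads 2 s F'' + d F' = - F / 2 <= 0, so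
    [first_order_le0] applied to F' gives F' <= 0. *)
Lemma bessel_series_le (T : R) : (forall s, 0 < s < T -> 0 <= F s) ->
  forall s t, 0 < s -> s < t -> t <= T -> F t <= F s.
Proof.
move=> F0 s t s0 st tT.
have F'0 : forall x, 0 < x <= T -> F' x <= 0.
  apply: (first_order_le0 d F' (bessel_series'' d)) => // x /F0 Fx.
  by have := odeF x; lra.
have [|c] := MVT st (fun x _ => dF x).
  exact/continuous_subspaceT/continuous_bessel_series.
rewrite in_itv/= => /andP[sc ct] e.
rewrite -subr_le0 e mulr_le0_ge0 ?subr_ge0 ?(ltW st)// F'0//.
by rewrite (lt_trans s0 sc) (le_trans (ltW ct)).
Qed.

(* The comparison function is [(1 - s / r) * expR (- (d / (4 r)) * s)]: with
   this exponent its defect in the differential equation factors through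
   [1 - s / r]. *)
Section lower_bound.
Variable r : R.
Hypothesis r_gt0 : 0 < r.
Hypothesis r_le : r <= d%:R ^+ 2 / 4 + 2 * d%:R.
Let a := d%:R / (4 * r).
Let G s := (1 - s / r) * expR (- a * s).
Let G' s := (- r^-1 - a * (1 - s / r)) * expR (- a * s).
Let G'' s := (2 * a / r + a ^+ 2 * (1 - s / r)) * expR (- a * s).

Let dA (s : R) : is_derive s 1 (fun s => 1 - s / r) (- r^-1).
Proof.
apply: (is_derive_eq (is_deriveB (is_derive_cst (1 : R) s 1)
  (is_deriveM (is_derive_id s (1 : R)) (is_derive_cst r^-1 s 1)))).
by rewrite /GRing.scale /= /cst; ring.
Qed.

Let dG (s : R) : is_derive s 1 G (G' s).
Proof.
apply: (is_derive_eq (is_deriveM (dA s) (is_derive_expRM (- a) s))).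
rewrite /G' /GRing.scale /=; ring.
Qed.

Let dG' (s : R) : is_derive s 1 G' (G'' s).
Proof.
have dB : is_derive s 1 (fun s => - r^-1 - a * (1 - s / r)) (a / r).
  apply: (is_derive_eq (is_deriveB (is_derive_cst (- r^-1) s 1)
    (is_deriveZ a (dA s)))).
  by rewrite /GRing.scale /=; ring.
apply: (is_derive_eq (is_deriveM dB (is_derive_expRM (- a) s))).
rewrite /G'' /GRing.scale /=; ring.
Qed.

Let LG_le0 (s : R) : 0 < s < r -> 4 * s * G'' s + 2 * d%:R * G' s + G s <= 0.
Proof.
move=> /andP[s0 sr].
have A0 : 0 <= 1 - s / r by rewrite subr_ge0 ler_pdivrMr// mul1r ltW.
have r0 : r != 0 by rewrite gt_eqF.
have -> : 4 * s * G'' s + 2 * d%:R * G' s + G s =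
  (1 - s / r) * expR (- a * s) *
  (d%:R ^+ 2 * s / (4 * r ^+ 2) - d%:R ^+ 2 / (2 * r) + 1 - 2 * d%:R / r).
  by rewrite /G /G' /G'' /a; field.
rewrite mulr_ge0_le0 ?mulr_ge0 ?expR_ge0//.
(* Both summands of the new numerator are nonpositive: the first because s < r, the second by
   [r_le]. *)
have -> : d%:R ^+ 2 * s / (4 * r ^+ 2) - d%:R ^+ 2 / (2 * r) + 1 - 2 * d%:R / r
 = (d%:R ^+ 2 * (s - r) / (4 * r) + (r - (d%:R ^+ 2 / 4 + 2 * d%:R))) / r.
  by field.
rewrite pmulr_lle0 ?invr_gt0// -[leRHS]addr0 lerD ?subr_le0//.
by rewrite pmulr_lle0 ?invr_gt0 ?mulr_gt0// mulr_ge0_le0 ?sqr_ge0// subr_le0 ltW.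
Qed.

Let bessel_series_ge_of_ge0 (T : R) : T < r ->
  (forall s, 0 < s < T -> 0 <= F s) -> forall s, 0 <= s <= T -> G s <= F s.
Proof.
move=> Tr F0 s sT; rewrite -lerN2 -(mulN1r (G s)).
apply: (@sturm_le _ d (fun s => - F s) (fun s => - F' s)
  (fun s => - bessel_series'' d s) G _ _ T d_gt0 _ _ _ dG dG') => //.
- by move=> x; apply: is_deriveN.
- by move=> x; apply: is_deriveN.
- by move=> x; have := odeF x; lra.
- move=> x /andP[x0 xT]; rewrite mulNr oppr_ge0 mulr_ge0_le0 ?F0 ?x0//.
  by apply: LG_le0; rewrite x0 (lt_trans xT).
- move=> x /andP[x0 xT]; rewrite /G mulr_gt0 ?expR_gt0// subr_gt0.
  by rewrite ltr_pdivrMr// mul1r (le_lt_trans xT).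
- by rewrite bessel_series0 /G mul0r subr0 mulr0 expR0 !mulr1.
Qed.

Lemma bessel_series_ge s : 0 <= s < r ->
  (1 - s / r) * expR (- (d%:R / (4 * r)) * s) <= F s.
Proof.
move=> /andP[s0 sr].
(* The first nonpositive value of [F] before [s] would contradict the bound. *)
pose Z := [set t | 0 <= t <= s /\ F t <= 0].
have G0 t : 0 <= t <= s -> 0 < G t.
  move=> /andP[_ ts]; rewrite /G mulr_gt0 ?expR_gt0// subr_gt0.
  by rewrite ltr_pdivrMr// mul1r (le_lt_trans ts).
suff Z0 : Z = set0.
  apply: (@bessel_series_ge_of_ge0 s); rewrite ?s0 ?lexx// => t /andP[t0 ts].
  rewrite leNgt; apply/negP => Ft; suff : Z t by rewrite Z0.
  by split; [rewrite !ltW|exact: ltW].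
apply/eqP/negPn/negP => /set0P Zne.
have lbZ : lbound Z 0 by move=> t [/andP[]].
pose t := inf Z.
(* Closedness puts the infimum [t] in Z. Then F > 0 before [t], so the conditional bound holds up to
   [t] and yields F t >= G t > 0, against F t <= 0. *)
have clZ : closed Z.
  rewrite (_ : Z = `[0, s]%classic `&` F @^-1` [set y | y <= 0]); last first.
    by apply/seteqP; split=> x; rewrite /Z/= in_itv.
  apply: closedI; first exact: interval_closed.
  by apply: closed_comp; [move=> x _; exact: continuous_bessel_series|exact: closed_le].
have [/andP[t0 ts] Ft] : Z t.
  apply: (itv_closed_infimums Zne clZ); split.
    by move=> x Zx; apply: ge_inf => //; exists 0.
  by move=> x lbx; exact: lb_le_inf.
have Fpos u : 0 <= u < t -> 0 < F u.
  move=> /andP[u0 ut]; rewrite ltNge; apply/negP => Fu.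
  have Zu : Z u by split=> //; rewrite u0 (le_trans (ltW ut)).
  have : t <= u by apply: ge_inf => //; exists 0.
  by rewrite leNgt ut.
have t_t : 0 <= t <= t by rewrite t0 lexx.
have : G t <= F t.
  apply: (@bessel_series_ge_of_ge0 t) => // [|u /andP[u0 ut]].
    exact: le_lt_trans sr.
  by rewrite ltW// Fpos// (ltW u0).
by rewrite leNgt (le_lt_trans Ft)// G0// t0.
Qed.

Hypothesis d_lt : d%:R < 2 * r.

(** Dividing by exp(-s/2) leaves (1 - s/r) exp(X) >= 1 with X = s (2r - d) / (4r). Since exp(X) >= 1
    + X, it suffices that (1 - s/r) (1 + X) >= 1, which follows from (1 - s/r) (2r - d) >= 4; this
    is the assumed bound on s. *)
Lemma bessel_series_ge_expR s : 0 <= s <= r * (1 - 4 / (2 * r - d%:R)) ->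
  expR (- (s / 2)) <= F s.
Proof.
move=> /andP[s0 sr]; have rd : 0 < 2 * r - d%:R by rewrite subr_gt0.
have r0 : r != 0 by rewrite gt_eqF.
have {}sr : 4 / (2 * r - d%:R) <= 1 - s / r.
  have : s / r <= 1 - 4 / (2 * r - d%:R) by rewrite ler_pdivrMr// mulrC.
  by lra.
have {}sr : 4 <= (1 - s / r) * (2 * r - d%:R) by rewrite -ler_pdivrMr.
have A0 : 0 < 1 - s / r by rewrite -(pmulr_lgt0 _ rd) (lt_le_trans _ sr).
apply: le_trans (bessel_series_ge s _); last first.
  by rewrite s0/= -[ltRHS]mul1r -ltr_pdivrMr// -subr_gt0.
pose X := s * (2 * r - d%:R) / (4 * r).
have X0 : 0 <= X by rewrite /X divr_ge0 ?mulr_ge0// ltW.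
have -> : expR (- (s / 2)) = expR (- X) * expR (- (d%:R / (4 * r)) * s).
  by rewrite -expRD; congr expR; rewrite /X; field.
rewrite ler_wpM2r ?expR_ge0// expRN.
rewrite -[leLHS]mul1r ler_pdivrMr ?expR_gt0//.
apply: le_trans (_ : (1 - s / r) * (1 + X) <= _); last first.
  by rewrite ler_wpM2l ?(ltW A0)// expR_ge1Dx.
have -> : (1 - s / r) * (1 + X) = 1 + s / (4 * r) * ((1 - s / r) * (2 * r - d%:R) - 4).
  by rewrite /X; field.
by rewrite lerDl mulr_ge0 ?subr_ge0// divr_ge0// mulr_ge0// ltW.
Qed.

End lower_bound.

Lemma bessel_series_gt0 (T : R) : (forall s, 0 < s <= T -> F s != 0) ->
  forall s, 0 <= s <= T -> 0 < F s.
Proof.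
move=> Fn0 s /andP[s0 sT]; rewrite ltNge; apply/negP => Fs.
have [||c] := @IVT _ F 0 s 0 s0.
- exact/continuous_subspaceT/continuous_bessel_series.
- by rewrite bessel_series0 ge_min le_max Fs ler01 orbT.
rewrite in_itv/= => /andP[c0 cs] Fc.
have : c != 0 by apply: contraPneq Fc => ->; rewrite bessel_series0; exact/eqP/oner_neq0.
rewrite neq_lt ltNge c0/= => {}c0.
by have := Fn0 c; rewrite c0 (le_trans cs)// Fc eqxx => /(_ isT).
Qed.

(** Up to the first zero r, F is nonnegative and the previous bound applies. If F s > 0 with r < s <
    t, a negative value between r and s would force another zero there; so F >= 0 on (0, s), F
    decreases, and F s <= F r = 0, a contradiction. *)
Lemma bessel_series_le_expR_second_zero (r t : R) : 0 < r < t -> F r = 0 -> F t = 0 ->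
  (forall s, 0 < s < t -> F s = 0 -> s = r) ->
  forall s, 0 <= s <= t -> F s <= expR (- (s / (2 * d%:R))).
Proof.
move=> /andP[r0 rt] Fr Ft Fz s /andP[s0 st].
have Fpos u : 0 < u < r -> 0 < F u.
  move=> /andP[u0 ur]; apply: (@bessel_series_gt0 u); rewrite ?lexx ?(ltW u0)//.
  move=> v /andP[v0 vu]; apply/eqP => Fv.
  have : v = r by apply: Fz => //; rewrite v0 (le_lt_trans vu)// (lt_trans ur).
  by move=> e; move: vu; rewrite e leNgt ur.
have [sr|rs] := leP s r.
  apply: (@bessel_series_le_expR r) => //; last by rewrite s0.
  by move=> u /Fpos/ltW.
apply: le_trans (expR_ge0 _).
move: st; rewrite le_eqVlt => /predU1P[->|st]; first by rewrite Ft.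
rewrite leNgt; apply/negP => Fs.
suff F0 : forall u, 0 < u < s -> 0 <= F u.
  by have := bessel_series_le _ F0 _ _ r0 rs (lexx _); rewrite Fr leNgt Fs.
move=> u /andP[u0 us]; have [ur|ru|->] := ltgtP u r; last by rewrite Fr.
  by rewrite ltW// Fpos// u0.
rewrite leNgt; apply/negP => Fu.
have [||c] := @IVT _ F u s 0 (ltW us).
- exact/continuous_subspaceT/continuous_bessel_series.
- by rewrite ge_min le_max (ltW Fu) (ltW Fs) orbT.
rewrite in_itv/= => /andP[uc cs] Fc.
have : c = r by apply: Fz => //; rewrite (lt_le_trans u0 uc) (le_lt_trans cs).
by move=> e; move: uc; rewrite e leNgt ru.
Qed.

End bessel_series_bounds.

(** * The radii *)

Section radii.
Context {R : realType} (d : nat).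
Notation D := (d%:R : R).

(** [Num.sqrt] is 0 at negative arguments; [4 <= 2 * r - D] keeps the radicand nonnegative, so the
    radius can be squared. *)
Let le_sq_rad (z r u : R) : 0 <= u -> 4 <= 2 * r - D -> u ^+ 2 = r ->
  0 <= z <= u * Num.sqrt (1 - 4 / (2 * r - D)) ->
  0 <= z ^+ 2 <= r * (1 - 4 / (2 * r - D)).
Proof.
move=> u0 r4 ur /andP[z0 zu]; rewrite sqr_ge0/=.
have rd : 0 < 2 * r - D by rewrite (lt_le_trans _ r4).
have h : 0 <= 1 - 4 / (2 * r - D) by rewrite subr_ge0 ler_pdivrMr// mul1r.
rewrite -[X in _ * X](sqr_sqrtr h) -[X in X * _]ur -exprMn lerXn2r ?nnegrE//.
exact: le_trans zu.
Qed.

Let powR_exprn (a x : R) n : (a `^ x) ^+ n = a `^ (x * n%:R).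
Proof. by rewrite powRrM powR_mulrn ?powR_ge0. Qed.

(* [b_radius] and [c_radius] are the same expression in [r], for
   [r = sqrt 2 * d^(3/2)] and [r = d^2 / 4 - 1]. *)
Lemma max_radius_sqr (z : R) : (2 <= d)%N -> 0 <= z <= max_radius R d ->
  exists r, [/\ 0 < r, r <= D ^+ 2 / 4 + 2 * D, D < 2 * r &
    0 <= z ^+ 2 <= r * (1 - 4 / (2 * r - D))].
Proof.
move=> d2; have D2 : 2 <= D by rewrite ler_nat.
suff [hb hc] : (0 <= z <= b_radius R d ->
  exists r, [/\ 0 < r, r <= D ^+ 2 / 4 + 2 * D, D < 2 * r &
    0 <= z ^+ 2 <= r * (1 - 4 / (2 * r - D))]) /\
  ((5 <= d)%N -> 0 <= z <= c_radius R d ->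
  exists r, [/\ 0 < r, r <= D ^+ 2 / 4 + 2 * D, D < 2 * r &
    0 <= z ^+ 2 <= r * (1 - 4 / (2 * r - D))]).
  rewrite /max_radius; case: leqP => // d5 /andP[z0].
  by rewrite le_max => /orP[zb|zc]; [apply: hb|apply: hc] => //; rewrite z0.
split.
  pose r : R := Num.sqrt 2 * D `^ (3 / 2).
  have d0 : 0 <= D by rewrite ler0n.
  have r0 : 0 <= r by rewrite mulr_ge0 ?sqrtr_ge0 ?powR_ge0.
  have rsq : r ^+ 2 = 2 * D ^+ 3.
    rewrite exprMn sqr_sqrtr// powR_exprn.
    by rewrite -[D ^+ 3]powR_mulrn//; congr (_ * _ `^ _); field.
  (* Comes from 2 D^3 >= 4 D^2. It gives 2 r - D >= 3 D >= 6, which settles all side conditions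
     except the upper bound on [r]. *)
  have r2d : 2 * D <= r.
    rewrite -(@ler_pXn2r _ 2)// ?nnegrE ?mulr_ge0// rsq.
    by rewrite exprMn !exprS expr0; nra.
  move=> zb; exists r; split; [by lra| |by lra|].
    rewrite -(@ler_pXn2r _ 2)// ?nnegrE ?addr_ge0 ?divr_ge0 ?mulr_ge0 ?sqr_ge0// rsq.
    (* AM-GM: (D^2/4 + 2D)^2 - (D^2/4 - 2D)^2 = 2 D^3 = r^2. *)
    have := sqr_ge0 (D ^+ 2 / 4 - 2 * D); rewrite !exprS !expr0; nra.
  apply: (le_sq_rad _ _ (2 `^ (1 / 4) * D `^ (3 / 4))).
  - by rewrite mulr_ge0 ?powR_ge0.
  - by lra.
  - rewrite exprMn !powR_exprn /r -powR12_sqrt//.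
    by congr (_ `^ _ * _ `^ _); field.
  - by move: zb; rewrite /b_radius /r mulrA.
move=> d5; have D5 : 5 <= D by rewrite ler_nat.
pose r : R := D ^+ 2 / 4 - 1.
(* Here d >= 5 is decisive: d = 4 would only give 2 r - D = 2. *)
have r4 : 4 <= 2 * r - D by rewrite /r expr2; nra.
have r0 : 0 < r by lra.
move=> zc; exists r; split => //; [by rewrite /r; lra|by lra|].
apply: (le_sq_rad _ _ (r `^ (1 / 2))) => //.
- exact: powR_ge0.
- rewrite powR_exprn (_ : 1 / 2 * 2%:R = 1); last by field.
  by rewrite powRr1// ltW.
- move: zc; rewrite /c_radius -/r.
  suff -> : 8 / (D ^+ 2 - 2 * D - 4) = 4 / (2 * r - D) by [].
  have e : D ^+ 2 - 2 * D - 4 = 2 * (2 * r - D) by rewrite /r; field.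
  rewrite e; have : 2 * r - D != 0 by rewrite gt_eqF// (lt_le_trans _ r4).
  by move: (2 * r - D) => y y0; field.
Qed.

End radii.

(** * The Gamma function *)

Section gamma_function.
Context {R : realType}.
Notation mu := (@lebesgue_measure R).

Definition gamma_integrand (a t : R) := t `^ a * expR (- t).
Local Notation g := gamma_integrand.

Let is_derive_powR_expRN (a t : R) : 0 < t ->
  is_derive t 1 (g a) (a * g (a - 1) t - g a t).
Proof.
move=> t0; have dN : is_derive t 1 (fun t : R => expR (- t)) (- expR (- t)).
  apply: (is_derive_eq (is_derive1_comp (is_derive_expR (- t)) (is_deriveNid t (1 : R)))).
  by rewrite mulrN1.
apply: (is_derive_eq (is_deriveM (is_derive1_powR a t0) dN)).
rewrite /GRing.scale /= /gamma_integrand; ring.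
Qed.

Lemma cvg_at_right0_powR (a : R) : 0 <= a -> t `^ a @[t --> 0^'+] --> (0 : R) `^ a.
Proof.
rewrite le_eqVlt => /predU1P[<-|a0].
  rewrite powRr0; apply: cvg_near_cst; apply: nearW => t; exact: powRr0.
by rewrite powR0 ?gt_eqF//; exact: powR_cvg0.
Qed.

Let cvg_at_right0_gamma (a : R) : 0 <= a -> g a t @[t --> 0^'+] --> g a 0.
Proof.
move=> a0; apply: cvgM; first exact: cvg_at_right0_powR.
apply: cvg_at_right_filter; apply: continuous_comp; first exact: opp_continuous.
exact: continuous_expR.
Qed.

Let within_continuous_gamma (a : R) : 0 <= a ->
  {within `[0, +oo[, continuous (g a)}.
Proof.
move=> a0; apply/continuous_within_itvcyP; split; last exact: cvg_at_right0_gamma.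
move=> t; rewrite in_itv/= andbT => t0.
apply: differentiable_continuous; apply/derivable1_diffP.
by have [] := is_derive_powR_expRN a t t0.
Qed.

(** Raise u <= exp(u) to the power a at u = t / (2a). *)
Lemma powR_le_expR2 (a t : R) : 0 <= a -> 0 <= t ->
  t `^ a <= (2 * a) `^ a * expR (t / 2).
Proof.
rewrite le_eqVlt => /predU1P[<- t0|a0 t0].
  by rewrite !powRr0 mul1r -[leLHS]expR0 ler_expR divr_ge0.
have -> : t = 2 * a * (t / (2 * a)) by field; rewrite gt_eqF.
have a2 : 0 <= 2 * a by rewrite mulr_ge0 ?(ltW a0).
rewrite powRM ?divr_ge0// ler_wpM2l ?powR_ge0//.
rewrite (_ : _ / 2 = t / (2 * a) * a); last by field; rewrite gt_eqF.
rewrite expRM ge0_ler_powR ?nnegrE ?expR_ge0 ?divr_ge0// ?(ltW a0)//.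
by apply: le_trans (expR_ge1Dx _); rewrite lerDr.
Qed.

Let gamma_le (a t : R) : 0 <= a -> 0 <= t -> g a t <= (2 * a) `^ a * expR (- (t / 2)).
Proof.
move=> a0 t0; rewrite (_ : - (t / 2) = t / 2 - t); last by field.
by rewrite expRD mulrA ler_wpM2r ?expR_ge0// powR_le_expR2.
Qed.

Let cvg_gamma (a : R) : 0 <= a -> g a t @[t --> +oo] --> 0.
Proof.
move=> a0.
have e0 : (2 * a) `^ a * expR (- (t / 2)) @[t --> +oo] --> 0.
  rewrite -(mulr0 ((2 * a) `^ a)); apply: cvgM; first exact: cvg_cst.
  apply: (@cvg_comp _ _ _ (fun t : R => t / 2) (fun t => expR (- t)) _ (pinfty_nbhs R)).
    exact: gt0_cvgMly.
  exact: cvgr_expR.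
apply: (squeeze_cvgr _ (cvg_cst 0) e0); near=> t.
by rewrite mulr_ge0 ?powR_ge0 ?expR_ge0//= gamma_le.
Unshelve. all: by end_near. Qed.

(** By [gamma_le] the integrand is dominated by a multiple of the exponential density of rate 1/2;
    the extra factor 2 cancels the normalization of that density. *)
Lemma integrable_gamma (a : R) : 0 <= a ->
  mu.-integrable `[0, +oo[ (EFin \o g a).
Proof.
move=> a0.
have ie : mu.-integrable `[0, +oo[ (EFin \o @exponential_pdf R 2^-1).
  exact: integrableS (@integrable_exponential_pdf R 2^-1 _).
apply: (le_integrable _ _ _ (integrableZl _ ((2 * a) `^ a * 2) ie)) => //.
  apply/measurable_EFinP; apply: subspace_continuous_measurable_fun => //.
  exact: within_continuous_gamma.
move=> t /=; rewrite in_itv/= andbT => t0.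
rewrite lee_fin ger0_norm ?mulr_ge0 ?powR_ge0 ?expR_ge0//.
rewrite exponential_pdfE// ger0_norm; last first.
  by rewrite !mulr_ge0 ?powR_ge0 ?expR_ge0// invr_ge0.
apply: le_trans (gamma_le _ _ a0 t0) _; rewrite -mulrA ler_wpM2l ?powR_ge0//.
by rewrite mulrA divff// mul1r mulNr mulrC.
Qed.

(* The integrand is minus the derivative of [g x + c g 0]; for [c >= x^x] it is
   nonnegative, as the fundamental theorem on a half-line requires. *)
Let Rintegral_gamma (x c : R) : 1 <= x -> x `^ x <= c ->
  \int[mu]_(t in `[0, +oo[) (g x t - x * g (x - 1) t + c * g 0 t) = c.
Proof.
move=> x1 xc; have x0 : 0 < x by exact: lt_le_trans x1.
have x10 : 0 <= x - 1 by rewrite subr_ge0.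
pose Phi t := - (g x t + c * g 0 t).
pose f t := g x t - x * g (x - 1) t + c * g 0 t.
have c0 : 0 <= c by rewrite (le_trans _ xc)// powR_ge0.
have f0 t : 0 <= t -> 0 <= f t.
  move=> t0; have -> : f t = (t `^ x - x * t `^ (x - 1) + c) * expR (- t).
    by rewrite /f /gamma_integrand powRr0; ring.
  (* For t >= x the difference t^x - x t^(x-1) = (t - x) t^(x-1) is nonnegative; for t < x the
     subtracted term is at most x^x <= c. *)
  rewrite mulr_ge0 ?expR_ge0//; have [xt|tx] := leP x t.
    rewrite addr_ge0// subr_ge0 -[leRHS](mulr_powRB1 t0 x0).
    by rewrite ler_wpM2r ?powR_ge0.
  rewrite -addrA addr_ge0 ?powR_ge0// addrC subr_ge0 (le_trans _ xc)//.
  rewrite -[leRHS](mulr_powRB1 (ltW x0) x0) ler_wpM2l ?(ltW x0)//.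
  by rewrite ge0_ler_powR// ?nnegrE ltW.
have cf : {within `[0, +oo[, continuous f}.
  move=> t; apply: cvgD; [apply: cvgB|].
  - exact: within_continuous_gamma (ltW x0) t.
  - by apply: cvgM; [exact: cvg_cst|exact: within_continuous_gamma].
  - by apply: cvgM; [exact: cvg_cst|exact: within_continuous_gamma].
have dPhi (t : R) : 0 < t -> is_derive t 1 Phi (f t).
  move=> t0; apply: (is_derive_eq (is_deriveN (is_deriveD
    (is_derive_powR_expRN x t t0) (is_deriveZ c (is_derive_powR_expRN 0 t t0))))).
  by rewrite /f /GRing.scale /=; ring.
rewrite /Rintegral (@ge0_continuous_FTC2y _ f Phi 0 0)//.
- rewrite /Phi /gamma_integrand powR0 ?gt_eqF// powRr0 oppr0 expR0.
  by rewrite -EFinB /= mul0r !mulr1 !add0r opprK.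
- have h : g x t + c * g 0 t @[t --> +oo] --> 0 + c * 0.
    apply: cvgD; first exact/cvg_gamma/ltW.
    by apply: cvgM; [exact: cvg_cst|exact: cvg_gamma].
  by rewrite mulr0 addr0 in h; rewrite -oppr0; exact: cvgN.
- by move=> t /dPhi[].
- apply: cvgN; apply: cvgD; first exact/cvg_at_right0_gamma/ltW.
  by apply: cvgM; [exact: cvg_cst|exact: cvg_at_right0_gamma].
- by move=> t; rewrite in_itv/= andbT derive1E => /dPhi[].
Qed.

Let GammaE (x : R) : 1 <= x -> Gamma x = \int[mu]_(t in `[0, +oo[) g (x - 1) t.
Proof.
move=> x1; rewrite /Gamma -[RHS]Rintegral_itv_obnd_cbnd//.
apply: integrableS (integrable_gamma (x - 1) _) => //; last by rewrite subr_ge0.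
by move=> t; rewrite /= !in_itv/= !andbT => /ltW.
Qed.

(** [Rintegral_gamma] splits into an identity affine in c, valid for all c >= x^x. Its instances at
    x^x and x^x + 1 give first that exp(-t) has integral 1, and then the functional equation. *)
Lemma GammaS (x : R) : 1 <= x -> Gamma (x + 1) = x * Gamma x.
Proof.
move=> x1; have x0 : 0 <= x by exact: le_trans x1.
have x10 : 0 <= x - 1 by rewrite subr_ge0.
rewrite !GammaE// ?lerDr// addrK.
have lin c : x `^ x <= c -> \int[mu]_(t in `[0, +oo[) g x t
    - x * \int[mu]_(t in `[0, +oo[) g (x - 1) t
    + c * \int[mu]_(t in `[0, +oo[) g 0 t = c.
  move=> xc; rewrite -[RHS](Rintegral_gamma x c x1 xc).
  have i1 := integrable_gamma x x0; have i2 := integrable_gamma _ x10.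
  have i3 := integrable_gamma 0 (lexx 0).
  have i2' : mu.-integrable `[0, +oo[ (EFin \o (fun t => x * g (x - 1) t)).
    by apply: eq_integrable (integrableZl _ x i2).
  have i3' : mu.-integrable `[0, +oo[ (EFin \o (fun t => c * g 0 t)).
    by apply: eq_integrable (integrableZl _ c i3).
  rewrite RintegralD//; last by apply: eq_integrable (integrableB _ i1 i2').
  by rewrite RintegralB// !RintegralZl.
have := lin _ (lexx _); have := lin (x `^ x + 1); rewrite lerDl ler01 => /(_ isT).
move: (\int[mu]_(t in `[0, +oo[) g 0 t) => K h1 h0.
have K1 : K = 1 by lra.
by rewrite K1 in h0; lra.
Qed.

(** On [1, 2] the integrand is at least exp(-2). *)
Lemma Gamma_gt0 (x : R) : 1 <= x -> 0 < Gamma x.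
Proof.
move=> x1.
have x10 : 0 <= x - 1 by rewrite subr_ge0.
have ig := integrable_gamma _ x10.
rewrite GammaE// fine_gt0//; apply/andP; split; last first.
  by rewrite ltey_eq; apply/orP; left; exact: integrable_fin_num.
have /integrableP[mg _] := ig.
have g0 t : (0 <= (g (x - 1) t)%:E)%E.
  by rewrite lee_fin mulr_ge0 ?powR_ge0 ?expR_ge0.
have sub12 : `[1 : R, 2] `<=` `[0, +oo[.
  by move=> t; rewrite /= !in_itv/= andbT => /andP[t1 _]; exact: le_trans t1.
apply: lt_le_trans (_ : \int[mu]_(t in `[1%R, 2%R]) (g (x - 1) t)%:E <= _)%E; last first.
  exact: ge0_subset_integral.
apply: lt_le_trans (_ : \int[mu]_(t in `[1%R, 2%R]) (expR (- 2))%:E <= _)%E.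
  rewrite integral_cst//= lebesgue_measure_itv/= lte_fin ltr1n/= -EFinD -EFinM.
  by rewrite lte_fin mulr_gt0 ?expR_gt0// subr_gt0 ltr1n.
apply: ge0_le_integral => //.
- exact: measurable_funS mg.
- move=> t; rewrite /= in_itv/= => /andP[t1 t2].
  rewrite lee_fin -[leLHS]mul1r ler_pM ?ler01 ?expR_ge0 ?ler_expR ?lerN2//.
  by rewrite -[leLHS](powRr0 t) ler_powR.
Qed.

End gamma_function.

(** * Moments of the Haar measure *)

Section matrix_measurability.
Context {R : realType} (d : nat).
Notation borel_matrix := (borel_matrix R d).

Lemma open_measurable_borel_matrix (A : set 'M[R]_d) : open A ->
  measurable (A : set borel_matrix).
Proof. by move=> oA; apply: sub_sigma_algebra. Qed.

Lemma continuous_measurable_borel_matrix (f : 'M[R]_d -> R) : continuous f ->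
  measurable_fun [set: borel_matrix] (f : borel_matrix -> R).
Proof.
move=> /continuousP cf; apply: (measurability _ (RGenOpens.measurableE R)).
move=> _ [_ [a [b ->] <-]]; rewrite setTI; apply: open_measurable_borel_matrix.
exact/cf/interval_open.
Qed.

Lemma measurable_entry i j :
  measurable_fun [set: borel_matrix] (fun M : borel_matrix => (M : 'M[R]_d) i j).
Proof.
apply: continuous_measurable_borel_matrix; exact: coord_continuous.
Qed.

Lemma continuous_mulmx (Q : 'M[R]_d) : continuous (fun M : 'M[R]_d => Q *m M).
Proof.
(* A neighbourhood of M contains a box with sides [P i j], so finitely many entrywise conditions
   suffice. *)
move=> M U [P nP PU].
have entry i j : nbhs M (fun N : 'M[R]_d => P i j ((Q *m N) i j)).
  have ce : continuous (fun N : 'M[R]_d => \sum_k Q i k * N k j).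
    apply: continuous_big => [|k _ N]; first exact: add_continuous.
    have c1 : {for N, continuous (fun N : 'M[R]_d => N k j)}.
      exact: coord_continuous.
    exact: (continuous_comp c1 (@mulrl_continuous R (Q i k) (N k j))).
  have : nbhs M (fun N : 'M[R]_d => P i j (\sum_k Q i k * N k j)).
    by apply: ce; have := nP i j; rewrite mxE.
  by apply: filterS => N; rewrite mxE.
have : nbhs M (fun N : 'M[R]_d => forall ij : 'I_d * 'I_d,
    P ij.1 ij.2 ((Q *m N) ij.1 ij.2)).
  by apply: (@filter_forall _ _ _ (nbhs M) (nbhs_filter M)) => -[i j]; exact: entry.
by apply: filterS => N h; apply: PU => i j; exact: (h (i, j)).
Qed.

Lemma measurable_mulmx (Q : 'M[R]_d) :
  measurable_fun [set: borel_matrix]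
    ((fun M : 'M[R]_d => Q *m M) : borel_matrix -> borel_matrix).
Proof.
apply: measurability; first exact: erefl.
move=> _ [B oB <-]; rewrite setTI; apply: open_measurable_borel_matrix.
by have /continuousP := continuous_mulmx Q; apply.
Qed.

Lemma measurable_orthogonal_group :
  measurable (@orthogonal_group R d : set borel_matrix).
Proof.
have -> : @orthogonal_group R d = \bigcap_(ij in [set: 'I_d * 'I_d])
    [set M : 'M[R]_d | \sum_k M k ij.1 * M k ij.2 = (ij.1 == ij.2)%:R].
  apply/seteqP; split => [M /= /matrixP MM ij _|M MM] /=.
    have := MM ij.1 ij.2; rewrite !mxE => <-.
    by apply: eq_bigr => k _; rewrite mxE.
  apply/matrixP => i j; have := MM (i, j) I; rewrite /= !mxE => <-.
  by apply: eq_bigr => k _; rewrite mxE.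
apply: fin_bigcap_measurable => // ij _.
have mf : measurable_fun [set: borel_matrix]
    (fun M : borel_matrix => \sum_k (M : 'M[R]_d) k ij.1 * (M : 'M[R]_d) k ij.2).
  by apply: measurable_sum => k; apply: measurable_funM; exact: measurable_entry.
have := mf measurableT _ (measurable_set1 (ij.1 == ij.2)%:R).
by rewrite setTI.
Qed.

End matrix_measurability.

(** * Dot products with columns and orthogonal matrices *)

Section dot_product.
Context {R : realType} {d : nat}.
Implicit Types (u v : 'cV[R]_d) (M Q : 'M[R]_d).

Definition sqnorm v : R := \sum_i v i 0 ^+ 2.

Definition dot_col (j : 'I_d) v M : R := \sum_i M i j * v i 0.

Lemma sqnormE v : sqnorm v = (v^T *m v) 0 0.
Proof. by rewrite mxE; apply: eq_bigr => i _; rewrite mxE expr2. Qed.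

Lemma sqr_euclid_norm v : euclid_norm v ^+ 2 = sqnorm v.
Proof. by rewrite sqr_sqrtr// sumr_ge0// => i _; exact: sqr_ge0. Qed.

Lemma dot_colE j v M : dot_col j v M = (M^T *m v) j 0.
Proof. by rewrite mxE; apply: eq_bigr => i _; rewrite mxE. Qed.

(** Moves a translation of the random matrix onto the fixed vector, where invariance can be
    exploited. *)
Lemma dot_col_mulmx j v Q M : dot_col j v (Q *m M) = dot_col j (Q^T *m v) M.
Proof. by rewrite !dot_colE trmx_mul mulmxA. Qed.

Lemma orthogonal_groupM Q M : @orthogonal_group R d Q ->
  @orthogonal_group R d (Q *m M) <-> @orthogonal_group R d M.
Proof.
rewrite /orthogonal_group /= => QQ.
by rewrite trmx_mul mulmxA -(mulmxA _ Q^T) QQ mulmx1.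
Qed.

Lemma sum_sqr_col j M : @orthogonal_group R d M -> \sum_i M i j ^+ 2 = 1.
Proof.
move=> /matrixP/(_ j j); rewrite !mxE eqxx mulr1n => <-.
by apply: eq_bigr => i _; rewrite mxE expr2.
Qed.

Lemma orthogonal_entry_le1 i j M : @orthogonal_group R d M -> `|M i j| <= 1.
Proof.
move=> /(sum_sqr_col j) h; rewrite -[leRHS](normr1 R) -ler_sqr ?nnegrE//.
rewrite !real_normK ?num_real// expr1n -h (bigD1 i)//= lerDl.
by apply: sumr_ge0 => k _; exact: sqr_ge0.
Qed.

Lemma dot_col_le j v M : @orthogonal_group R d M ->
  `|dot_col j v M| <= \sum_i `|v i 0|.
Proof.
move=> oM; apply: le_trans (ler_norm_sum _ _ _) _; apply: ler_sum => i _.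
by rewrite normrM ler_piMl// orthogonal_entry_le1.
Qed.

(* The Householder reflection along [u - v]. *)
Lemma orthogonal_transitive u v : sqnorm u = sqnorm v ->
  exists2 Q, @orthogonal_group R d Q & Q^T *m u = v.
Proof.
move=> uv; have [->|nuv] := eqVneq u v.
  by exists 1%:M; rewrite /orthogonal_group /= ?trmx1 ?mul1mx.
pose w := u - v; pose k := 2 / sqnorm w.
have w0 : sqnorm w != 0.
  apply: contraNneq nuv => w0; rewrite -subr_eq0 -/w; apply/eqP/matrixP => i j.
  rewrite ord1 [RHS]mxE; apply/eqP; rewrite -sqrf_eq0; apply/eqP.
  exact: (psumr_eq0P (fun l _ => sqr_ge0 (w l 0)) w0).
pose Q := 1%:M - k *: (w *m w^T).
have QT : Q^T = Q by rewrite /Q linearB /= linearZ /= trmx_mul trmxK trmx1.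
have wTw : w^T *m w = (sqnorm w)%:M by rewrite [LHS]mx11_scalar -sqnormE.
exists Q.
  rewrite /orthogonal_group /= QT /Q mulmxBl mul1mx mulmxBr mulmx1.
  rewrite -scalemxAl -scalemxAr -mulmxA (mulmxA w^T) wTw mul_scalar_mx.
  rewrite -scalemxAr !scalerA.
  have -> : k * (k * sqnorm w) = k + k by rewrite /k; field.
  by rewrite scalerDl opprB addrK addrNK.
rewrite QT /Q mulmxBl mul1mx -scalemxAl -mulmxA.
(* As u and v have equal norms, w . u = |w|^2 / 2, so the reflection subtracts exactly w from u. *)
have -> : w^T *m u = (sqnorm w / 2)%:M.
  rewrite [LHS]mx11_scalar; congr _%:M; apply: (mulIf (x := 2)) => //.
  rewrite divfK// mxE /sqnorm mulr_suml.
  transitivity (\sum_i (w i 0 ^+ 2 + (u i 0 ^+ 2 - v i 0 ^+ 2))).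
    by apply: eq_bigr => i _; rewrite !mxE; ring.
  by rewrite big_split /= sumrB -[\sum_i u i 0 ^+ 2]/(sqnorm u) uv subrr addr0.
rewrite mul_mx_scalar scalerA (_ : k * _ = 1); last by rewrite /k; field.
by rewrite scale1r /w opprB addrC subrK.
Qed.

End dot_product.

(** A nonzero difference of size n would have the n distinct roots 0, ..., n - 1. *)
Lemma eq_horner_poly {R : numDomainType} (p q : {poly R}) :
  (forall x, p.[x] = q.[x]) -> p = q.
Proof.
move=> pq; apply/eqP; rewrite -subr_eq0; apply/negPn/negP => r0.
set r := p - q in r0.
have := @max_poly_roots _ r [seq i%:R | i <- iota 0 (size r)] r0.
rewrite size_map size_iota ltnn => h; suff: false by []; apply: h.
  by apply/allP => x _; rewrite /root /r hornerD hornerN pq subrr.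
rewrite map_inj_uniq ?iota_uniq// => m n /eqP.
by rewrite eqr_nat => /eqP.
Qed.

Lemma coef2_exp_1DX2 {R : comNzRingType} n : ((1 + 'X^2) ^+ n : {poly R})`_2 = n%:R.
Proof.
suff [] : ((1 + 'X^2) ^+ n : {poly R})`_0 = 1 /\ ((1 + 'X^2) ^+ n : {poly R})`_2 = n%:R.
  by [].
elim: n => [|n [ih0 ih2]]; first by rewrite expr0 !coef1.
rewrite exprS mulrDl mul1r !coefD !coefXnM /= ih0 ih2.
by rewrite addr0 mulrS addrC.
Qed.

(** * Integrals and moments over the orthogonal group *)

Section haar_moments.
Context {R : realType} (d : nat).
Variable mu : probability (borel_matrix R d) R.
Hypothesis haar_mu : is_haar_orthogonal mu.
Notation D := (@orthogonal_group R d).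
Implicit Types (f g : borel_matrix R d -> R) (v : 'cV[R]_d).

Let mD : measurable (D : set (borel_matrix R d)).
Proof. exact: measurable_orthogonal_group. Qed.

(** The bound is asked on O(d) only, entries being unbounded on the ambient space. The class is
    closed under sums and products, so polynomials in the entries are integrable. *)
Definition haar_bounded f := measurable_fun setT f /\
  exists K, forall M, D M -> `|f M| <= K.

Lemma haar_bounded_integrable f : haar_bounded f -> mu.-integrable D (EFin \o f).
Proof.
move=> [mf [K fK]]; apply: measurable_bounded_integrable => //.
- by rewrite (le_lt_trans (probability_le1 mu mD))// ltry.
- exact: measurable_funTS.
- exists K; split; first exact: num_real.
  by move=> K' KK' M DM; rewrite /= (le_trans (fK _ DM))// ltW.
Qed.

Lemma haar_bounded_cst (k : R) : haar_bounded (fun=> k).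
Proof. by split=> //; exists `|k|. Qed.

Lemma haar_boundedD f g : haar_bounded f -> haar_bounded g ->
  haar_bounded (fun M => f M + g M).
Proof.
move=> [mf [K fK]] [mg [L gL]]; split; first exact: measurable_funD.
exists (K + L) => M DM; rewrite (le_trans (ler_normD _ _))//.
by rewrite lerD ?fK ?gL.
Qed.

Lemma haar_boundedM f g : haar_bounded f -> haar_bounded g ->
  haar_bounded (fun M => f M * g M).
Proof.
move=> [mf [K fK]] [mg [L gL]]; split; first exact: measurable_funM.
by exists (K * L) => M DM; rewrite normrM ler_pM ?fK ?gL.
Qed.

Lemma haar_boundedX f n : haar_bounded f -> haar_bounded (fun M => f M ^+ n).
Proof.
move=> bf; elim: n => [|n ih]; first exact: haar_bounded_cst.
by under eq_fun do rewrite exprS; exact: haar_boundedM.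
Qed.

Lemma haar_bounded_sum I (s : seq I) (F : I -> borel_matrix R d -> R) :
  (forall i, haar_bounded (F i)) -> haar_bounded (fun M => \sum_(i <- s) F i M).
Proof.
move=> bF; elim: s => [|i s ih].
  by under eq_fun do rewrite big_nil; exact: haar_bounded_cst.
by under eq_fun do rewrite big_cons; exact: haar_boundedD.
Qed.

Lemma haar_bounded_entry i j : haar_bounded (fun M => (M : 'M[R]_d) i j).
Proof.
split; first exact: measurable_entry.
by exists 1 => M DM; exact: orthogonal_entry_le1.
Qed.

Lemma haar_bounded_dot_col j v : haar_bounded (dot_col j v).
Proof.
apply: haar_bounded_sum => i; apply: haar_boundedM.
  exact: haar_bounded_entry.
exact: haar_bounded_cst.
Qed.

Lemma haar_bounded_cos j v : haar_bounded (fun M => cos (dot_col j v M)).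
Proof.
split; last by exists 1 => M _; rewrite ler_norml cos_geN1 cos_le1.
have mcos : measurable_fun setT (@cos R).
  by apply: continuous_measurable_fun; exact: continuous_cos.
exact: (measurableT_comp mcos (proj1 (haar_bounded_dot_col j v))).
Qed.

Notation "''E' f" := (Rintegral mu D f) (at level 10, f at level 8).

Lemma haar_Rintegral_cst k : 'E (fun=> k) = k.
Proof.
rewrite Rintegral_cst// -[RHS]mulr1; congr (_ * _).
exact: (congr1 fine haar_mu.1).
Qed.

Lemma haar_Rintegral_sum I (s : seq I) (F : I -> borel_matrix R d -> R) :
  (forall i, haar_bounded (F i)) ->
  'E (fun M => \sum_(i <- s) F i M) = \sum_(i <- s) 'E (F i).
Proof.
move=> bF; elim: s => [|i s ih].
  under eq_Rintegral do rewrite big_nil.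
  by rewrite haar_Rintegral_cst big_nil.
under eq_Rintegral do rewrite big_cons.
rewrite RintegralD// ?big_cons ?ih//; apply: haar_bounded_integrable => //.
exact: haar_bounded_sum.
Qed.

(** Change of variables along [phi]: O(d) is its own preimage, and by invariance the pushforward of
    [mu] agrees with [mu] on measurable sets. *)
Lemma haar_Rintegral_mulmx f (Q : 'M[R]_d) : haar_bounded f -> D Q ->
  'E (fun M => f (Q *m M)) = 'E f.
Proof.
move=> bf DQ; have [mf [K fK]] := bf.
pose phi : borel_matrix R d -> borel_matrix R d := fun M => Q *m M.
have mphi : measurable_fun setT phi by exact: measurable_mulmx.
have phiD : phi @^-1` D = D.
  by apply/seteqP; split => M; rewrite /phi/= => /(orthogonal_groupM _ _ DQ).
have bfphi : haar_bounded (f \o phi).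
  split; first exact: measurableT_comp.
  by exists K => M DM; apply: fK; exact/(orthogonal_groupM _ _ DQ).
have ifphi : mu.-integrable (phi @^-1` D) ((EFin \o f) \o phi).
  by rewrite phiD; exact: haar_bounded_integrable.
congr fine; have := integral_pushforward mphi _ ifphi mD.
rewrite phiD => <-; last exact/measurable_EFinP.
apply: eq_measure_integral => A mA _.
exact: haar_mu.2.
Qed.

Variables (j i0 : 'I_d).
Definition haar_moment n := 'E (fun M => (M : 'M[R]_d) i0 j ^+ n).

(** Some orthogonal matrix carries |v| e_(i0) to v, so invariance reduces w . v to |v| times a
    single entry; the even exponent removes the square root. *)
Lemma haar_Rintegral_dot_col n v :
  'E (fun M => dot_col j v M ^+ (2 * n)) = sqnorm v ^+ n * haar_moment (2 * n).
Proof.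
have v0 : 0 <= sqnorm v by apply: sumr_ge0 => i _; exact: sqr_ge0.
pose u : 'cV[R]_d := Num.sqrt (sqnorm v) *: delta_mx i0 0.
have uE i : u i 0 = Num.sqrt (sqnorm v) * (i == i0)%:R by rewrite !mxE eqxx andbT.
have uv : sqnorm u = sqnorm v.
  rewrite [LHS](bigD1 i0)//= big1 => [|i ii0]; rewrite uE ?eqxx.
    by rewrite mulr1 addr0 sqr_sqrtr.
  by rewrite (negbTE ii0) mulr0 expr0n.
have [Q DQ Quv] := orthogonal_transitive _ _ uv.
rewrite -Quv; under eq_Rintegral do rewrite -dot_col_mulmx.
rewrite (haar_Rintegral_mulmx (fun M => dot_col j u M ^+ (2 * n)))//; last first.
  exact/haar_boundedX/haar_bounded_dot_col.
rewrite -RintegralZl//; last first.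
  exact/haar_bounded_integrable/haar_boundedX/haar_bounded_entry.
apply: eq_Rintegral => M _.
rewrite /dot_col (bigD1 i0)//= big1 => [|i ii0]; rewrite uE ?eqxx.
  by rewrite mulr1 addr0 Quv exprMn mulrC; congr (_ * _); rewrite exprM sqr_sqrtr.
by rewrite (negbTE ii0) !mulr0.
Qed.

(* Both sides of [E (M i0 j + b * M i j)^(2 n + 2) = (1 + b^2)^(n+1) * C] are
   polynomials in [b]; compare the coefficients of [b^2]. *)
Lemma haar_moment_mixed n i : i != i0 ->
  (2 * n + 1)%:R *
    'E (fun M => (M : 'M[R]_d) i0 j ^+ (2 * n) * (M : 'M[R]_d) i j ^+ 2) =
  haar_moment (2 * n.+1).
Proof.
move=> ii0; pose m := (2 * n.+1)%N.
pose f k (M : borel_matrix R d) :=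
  (M : 'M[R]_d) i0 j ^+ (m - k) * (M : 'M[R]_d) i j ^+ k.
have bf k : haar_bounded (f k).
  by apply: haar_boundedM; exact/haar_boundedX/haar_bounded_entry.
have bfZ k a : haar_bounded (fun M => a * f k M).
  by apply: haar_boundedM => //; exact: haar_bounded_cst.
have expansion : \poly_(k < m.+1) ('C(m, k)%:R * 'E (f k)) =
    haar_moment m *: (1 + 'X^2) ^+ n.+1.
  apply: eq_horner_poly => b; rewrite horner_poly hornerZ horner_exp.
  rewrite hornerD hornerXn hornerC.
  pose v : 'cV[R]_d := delta_mx i0 0 + b *: delta_mx i 0.
  have vE k : v k 0 = (k == i0)%:R + b * (k == i)%:R by rewrite !mxE eqxx !andbT.
  have vi0 : v i0 0 = 1 by rewrite vE eqxx eq_sym (negbTE ii0) mulr0 addr0.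
  have vi : v i 0 = b by rewrite vE eqxx (negbTE ii0) mulr1 add0r.
  have v0 k : k != i0 -> k != i -> v k 0 = 0.
    by move=> /negbTE k0 /negbTE ki; rewrite vE k0 ki mulr0 addr0.
  have sqv : sqnorm v = 1 + b ^+ 2.
    rewrite /sqnorm (bigD1 i0)//= (bigD1 i)//= big1 ?addr0 ?vi0 ?vi ?expr1n//.
    by move=> k /andP[k0 ki]; rewrite v0// expr0n.
  have dotv (M : 'M[R]_d) : dot_col j v M = M i0 j + b * M i j.
    rewrite /dot_col (bigD1 i0)//= (bigD1 i)//= big1 ?addr0 ?vi0 ?vi ?mulr1//.
      by rewrite mulrC.
    by move=> k /andP[k0 ki]; rewrite v0// mulr0.
  rewrite mulrC -sqv -haar_Rintegral_dot_col.
  transitivity ('E (fun M => \sum_(k < m.+1) 'C(m, k)%:R * b ^+ k * f k M)).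
    rewrite (haar_Rintegral_sum _ _ (fun (k : 'I_m.+1) M => 'C(m, k)%:R * b ^+ k * f k M)) => [|//].
    apply: eq_bigr => k _; rewrite RintegralZl//; last exact: haar_bounded_integrable.
    by rewrite mulrAC.
  apply: eq_Rintegral => M _; rewrite dotv exprDn; apply: eq_bigr => k _.
  by rewrite /f exprMn -[RHS]mulr_natl; ring.
have /(congr1 (fun p : {poly R} => p`_2)) := expansion.
rewrite coef_poly coefZ coef2_exp_1DX2.
have -> : (2 < m.+1)%N by rewrite /m mulnS.
(* The right side contributes n + 1 as coefficient of b^2, which cancels against this factor of the
   binomial. *)
have -> : 'C(m, 2) = (n.+1 * (2 * n + 1))%N.
  by rewrite bin2 -[RHS]doubleK -muln2 /m; congr _./2; nia.
have -> : f 2 = fun M => (M : 'M[R]_d) i0 j ^+ (2 * n) * (M : 'M[R]_d) i j ^+ 2.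
  by rewrite /f /m mulnS addKn.
rewrite natrM -mulrA [RHS]mulrC => /mulfI; apply.
by rewrite pnatr_eq0.
Qed.

(** Insert 1 = sum_k (M k j)^2. After multiplication by 2n + 1, the index i0 contributes 2n + 1
    copies of the next even moment and each of the d - 1 others one copy, d + 2n in all. *)
Lemma haar_momentS n :
  (2 * n + 1)%:R * haar_moment (2 * n) = (d + 2 * n)%:R * haar_moment (2 * n.+1).
Proof.
pose f k (M : borel_matrix R d) :=
  (M : 'M[R]_d) i0 j ^+ (2 * n) * (M : 'M[R]_d) k j ^+ 2.
have -> : haar_moment (2 * n) = \sum_k 'E (f k).
  rewrite -haar_Rintegral_sum; last first.
    by move=> k; apply: haar_boundedM; exact/haar_boundedX/haar_bounded_entry.
  apply: eq_Rintegral => M; rewrite inE => DM.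
  by rewrite -mulr_sumr sum_sqr_col// mulr1.
rewrite (bigD1 i0)//= mulrDr.
rewrite [X in X + _](_ : _ = (2 * n + 1)%:R * haar_moment (2 * n.+1)); last first.
  congr (_ * _); apply: eq_Rintegral => M _.
  by rewrite /f -exprD mulnS addnC.
rewrite mulr_sumr (eq_bigr (fun=> haar_moment (2 * n.+1))); last first.
  by move=> k k0; exact: haar_moment_mixed.
rewrite sumr_const cardC1 card_ord -[X in _ + X]mulr_natl -mulrDl; congr (_ * _).
by rewrite -natrD; congr _%:R; have := ltn_ord i0; lia.
Qed.

End haar_moments.

(** Majorant for dominated convergence: since (2k)! >= k!, the cosine terms are bounded by those of
    the exponential series at x^2. *)
Lemma series_cos_coeff'_le {R : realType} (x : R) n :
  `|series (cos_coeff' x) n| <= expR (x ^+ 2).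
Proof.
apply: le_trans (ler_norm_sum _ _ _) _.
apply: le_trans (_ : series (exp_coeff (x ^+ 2)) n <= _); last first.
  apply: nondecreasing_cvgn_le; last exact: is_cvg_series_exp_coeff.
  apply/nondecreasing_seqP => k; rewrite /series /= big_nat_recr//= lerDl.
  by rewrite exp_coeff_ge0 ?sqr_ge0.
rewrite /series /=; apply: ler_sum => k _.
rewrite /cos_coeff' /exp_coeff /= !normrM normfV normr_nat.
rewrite -exprnP normrX normrN1 expr1n mul1r -mul2n exprM.
have xk : 0 <= x ^+ 2 ^+ k by rewrite exprn_ge0// sqr_ge0.
rewrite (ger0_norm xk) ler_wpM2l//.
rewrite lef_pV2 ?posrE ?ltr0n ?fact_gt0// ler_nat.
by rewrite leq_fact// leq_pmull.
Qed.

(** * Expected cosine of a random projection *)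

Section haar_cos.
Context {R : realType} {d : nat}.
Variable mu : probability (borel_matrix R d) R.
Hypothesis haar_mu : is_haar_orthogonal mu.
Notation D := (@orthogonal_group R d).
Notation "''E' f" := (Rintegral mu D f) (at level 10, f at level 8).
Implicit Types (v : 'cV[R]_d).

(** Both sides are 1 at n = 0 and obey [bessel_coefS]; for the moments this is [haar_momentS]
    together with (2n+2)! = (2n+2) (2n+1) (2n)!. *)
Lemma haar_moment_bessel_coef (j i0 : 'I_d) n :
  (-1) ^+ n * haar_moment d mu j i0 (2 * n) / (2 * n)`!%:R = bessel_coef d n.
Proof.
have d0 : (0 < d)%N by exact: leq_trans (ltn_ord i0).
elim: n => [|n ih].
  rewrite muln0 fact0 divr1 expr0 mul1r /bessel_coef big_ord0 !expr0 !mulr1 divr1.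
  by rewrite /haar_moment; under eq_Rintegral do rewrite expr0; exact: haar_Rintegral_cst.
have dn : (d + 2 * n)%:R != 0 :> R by rewrite pnatr_eq0 -lt0n addn_gt0 d0.
have n1 : 2 * n.+1%:R != 0 :> R by rewrite mulf_neq0 ?pnatr_eq0.
apply: (mulIf (mulf_neq0 n1 dn)); rewrite bessel_coefS// -ih.
have := haar_momentS d mu haar_mu j i0 n; rewrite mulnS !factS !natrM.
move: (haar_moment _ _ _ _ _) (haar_moment _ _ _ _ _) => b a ab.
have f0 : (2 * n)`!%:R != 0 :> R by rewrite pnatr_eq0 -lt0n fact_gt0.
have n2 : (2 * n).+1%:R != 0 :> R by rewrite pnatr_eq0.
have -> : a = (d + 2 * n)%:R * b / (2 * n).+1%:R.
  by rewrite -ab addn1 mulrC mulKf.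
have -> : (2 * n).+2%:R = 2 * n.+1%:R :> R by rewrite -natrM mulnS.
move: n1 n2 f0 dn; rewrite exprS.
move: (2 * n.+1%:R) (2 * n).+1%:R (2 * n)`!%:R (d + 2 * n)%:R => A B C E A0 B0 C0 E0.
by field; rewrite A0 B0 C0.
Qed.

(** The cosine series is integrated termwise by dominated convergence: on O(d), |w . v| is at most
    the sum of the |v_i|, so the constant [K] bounds all partial sums. *)
Lemma haar_Rintegral_cos (j : 'I_d) v :
  'E (fun M => cos (dot_col j v M)) = bessel_series d (sqnorm v).
Proof.
have bf n : haar_bounded d (fun M => series (cos_coeff' (dot_col j v M)) n).
  rewrite /series /=; apply: haar_bounded_sum => k.
  apply: haar_boundedM; last exact: haar_bounded_cst.
  apply: haar_boundedM; first exact: haar_bounded_cst.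
  exact/haar_boundedX/haar_bounded_dot_col.
pose K := expR ((\sum_i `|v i 0|) ^+ 2).
have [mcos _] := haar_bounded_cos d j v.
have mD : measurable (D : set (borel_matrix R d)).
  exact: measurable_orthogonal_group.
have [icos _ lim_cos] : [/\ mu.-integrable D (EFin \o (fun M => cos (dot_col j v M))),
    True & (fun n => \int[mu]_(M in D) (series (cos_coeff' (dot_col j v M)) n)%:E)%E
      @ \oo --> (\int[mu]_(M in D) (cos (dot_col j v M))%:E)%E].
  have [] := @dominated_convergence _ _ _ mu D mD
    (fun n M => (series (cos_coeff' (dot_col j v M)) n)%:E)
    (fun M => (cos (dot_col j v M))%:E) (cst K%:E) _ _ _ _ _ => //.
  - by move=> n; apply/measurable_EFinP/measurable_funTS; have [] := bf n.
  - exact/measurable_EFinP/measurable_funTS.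
  - apply: aeW => M DM; apply: cvg_EFin; first exact: nearW.
    exact: cvg_cos_coeff'.
  - exact: (haar_bounded_integrable d mu _ (haar_bounded_cst d K)).
  - apply: aeW => M n DM; rewrite lee_fin; apply: le_trans (series_cos_coeff'_le _ _) _.
    rewrite ler_expR -[X in X <= _]real_normK ?num_real// ler_sqr ?nnegrE//.
      exact: dot_col_le.
    exact: sumr_ge0.
have fin_cos := integrable_fin_num mD icos.
move: lim_cos; rewrite -(fineK fin_cos) => /fine_cvg.
have -> : fine \o (fun n => \int[mu]_(M in D) (series (cos_coeff' (dot_col j v M)) n)%:E)%E
    = pseries (bessel_coef d) (sqnorm v).
  apply/funext => n /=.
  rewrite -[LHS]/('E (fun M => \sum_(0 <= k < n) cos_coeff' (dot_col j v M) k)).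
  rewrite (haar_Rintegral_sum _ _ haar_mu); last first.
    move=> k; apply: haar_boundedM; last exact: haar_bounded_cst.
    apply: haar_boundedM; first exact: haar_bounded_cst.
    exact/haar_boundedX/haar_bounded_dot_col.
  apply: eq_bigr => k _.
  under eq_Rintegral do rewrite /cos_coeff' -exprnP mulrAC -mul2n.
  rewrite RintegralZl//; last first.
    exact/haar_bounded_integrable/haar_boundedX/haar_bounded_dot_col.
  rewrite (haar_Rintegral_dot_col _ _ haar_mu j j) /= -(haar_moment_bessel_coef j j).
  ring.
by move=> /(cvg_lim (@Rhausdorff R)) h; exact/esym/h.
Qed.

End haar_cos.

Lemma orf_kernelE {R : realType} (p d : nat) (W : 'M[R]_(d, p)) (x y : 'cV[R]_d) :
  orf_kernel W x y = p%:R^-1 * \sum_k cos (((col k W)^T *m (x - y)) 0 0).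
Proof.
rewrite /orf_kernel /orf_feature [(_ *: _)^T]linearZ/= -scalemxAl -scalemxAr.
rewrite scalerA mxE.
rewrite -invfM -expr2 sqr_sqrtr ?ler0n//; congr (_ * _).
rewrite tr_col_mx mul_row_col mxE ![in LHS]mxE -big_split /=.
apply: eq_bigr => k _; rewrite ![in LHS]mxE.
have -> : ((col k W)^T *m (x - y)) 0 0 =
    ((col k W)^T *m x) 0 0 - ((col k W)^T *m y) 0 0.
  by rewrite mulmxBr [LHS]mxE [X in _ + X]mxE.
by rewrite cosB addrC ![(_ *m _) 0 0]mxE.
Qed.

(** * The expected kernel *)

(** Iterates [GammaS] from d/2; d >= 2 keeps every argument at least 1, and each step yields a
    factor (d + 2k) / 2. *)
Lemma Gamma_half_shift {R : realType} (d n : nat) : (2 <= d)%N ->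
  Gamma (n%:R + d%:R / 2 : R) * 2 ^+ n =
  Gamma (d%:R / 2 : R) * \prod_(k < n) (d + 2 * k)%:R.
Proof.
move=> d2; have D2 : 2 <= d%:R :> R by rewrite ler_nat.
elim: n => [|n ih]; first by rewrite add0r big_ord0 expr0.
have xn : 1 <= n%:R + d%:R / 2 :> R.
  by rewrite -[leLHS]add0r lerD// ler_pdivlMr// mul1r.
rewrite big_ord_recr/= mulrA -ih -natr1 addrAC GammaS// exprS natrD natrM.
by field.
Qed.

Lemma bessel_jE {R : realType} (d : nat) (z : R) : (2 <= d)%N ->
  bessel_j d z = bessel_series d (z ^+ 2).
Proof.
move=> d2; have D2 : 2 <= d%:R :> R by rewrite ler_nat.
congr (limn _); apply/funext => N; apply: eq_bigr => n _.
have G0 k : Gamma (k%:R + d%:R / 2 : R) != 0.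
  by rewrite gt_eqF// Gamma_gt0// -[leLHS]add0r lerD// ler_pdivlMr// mul1r.
have := Gamma_half_shift (R := R) d n d2; have := G0 n; have := G0 0%N.
rewrite add0r /bessel_coef exprM.
have : \prod_(k < n) (d + 2 * k)%:R != 0 :> R.
  by apply/prodf_neq0 => k _; rewrite pnatr_eq0 -lt0n addn_gt0 (ltnW d2).
have : n`!%:R != 0 :> R by rewrite pnatr_eq0 -lt0n fact_gt0.
have : 2 ^+ n != 0 :> R by rewrite expf_neq0.
rewrite /= !expr_div_n [2 ^+ 2 ^+ n]exprAC.
move: (Gamma _) (Gamma _) (\prod_(k < n) _) (2 ^+ n) => A B C t t0 f0 C0 B0 A0 e.
have -> : B = A * t / C by rewrite e mulfK.
by field; rewrite t0 f0 A0 C0.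
Qed.

(** The expectation is transported to the law [mu] of the matrix and restricted to O(d), whose
    complement is null; there each of the p cosines has the same integral by
    [haar_Rintegral_cos]. *)
Lemma expectation_orf_kernel {R : realType} (p d : nat)
    (disp : measure_display) (Omega : measurableType disp)
    (P : probability Omega R) (O : {RV P >-> borel_matrix R d})
    (c : 'I_p -> 'I_d) (x y : 'cV[R]_d) :
  (0 < p)%N -> is_haar_orthogonal (distribution P O) ->
  ('E_P[fun w => orf_kernel (colsub c (O w : 'M[R]_d)) x y] =
  (bessel_series d (sqnorm (x - y)))%:E)%E.
Proof.
move=> p0 hO; pose mu : probability (borel_matrix R d) R := distribution P O.
have haar_mu : is_haar_orthogonal mu by [].
pose f (M : borel_matrix R d) := p%:R^-1 * \sum_k cos (dot_col (c k) (x - y) M).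
have kernelE (M : 'M[R]_d) : orf_kernel (colsub c M) x y = f M.
  rewrite orf_kernelE; congr (_ * _); apply: eq_bigr => k _; congr cos.
  by rewrite mxE; apply: eq_bigr => i _; rewrite !mxE.
have bsum : haar_bounded d (fun M => \sum_k cos (dot_col (c k) (x - y) M)).
  by apply: haar_bounded_sum => k; exact: haar_bounded_cos.
have [mf _] := haar_boundedM _ _ _ (haar_bounded_cst d p%:R^-1) bsum.
(* The bound holds on all matrices, hence integrability both under [mu] and, through [O], under
   [P]. *)
have f_le M : `|f M| <= 1.
  rewrite /f normrM normfV normr_nat mulrC ler_pdivrMr ?ltr0n// mul1r.
  apply: le_trans (ler_norm_sum _ _ _) _.
  rewrite -[leRHS](_ : \sum_(k < p) 1 = _); last by rewrite sumr_const card_ord.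
  by apply: ler_sum => k _; rewrite ler_norml cos_geN1 cos_le1.
have int_f d' (T : measurableType d') (nu : probability T R) (X : T -> borel_matrix R d) :
    measurable_fun setT X -> nu.-integrable setT ((EFin \o f) \o X).
  move=> mX; apply: measurable_bounded_integrable => //.
  - exact: le_lt_trans (probability_le1 nu measurableT) (ltry 1).
  - exact: measurableT_comp mf mX.
  - exists 1; split => // r r1 t _; exact: le_trans (f_le _) (ltW r1).
have mD : measurable (@orthogonal_group R d : set (borel_matrix R d)).
  exact: measurable_orthogonal_group.
have mu0 : mu (~` (@orthogonal_group R d)) = 0%E.
  by rewrite probability_setC// (_ : mu _ = 1%E) ?subee//; case: haar_mu.
rewrite unlock; under eq_integral do rewrite kernelE.
transitivity (\int[mu]_M (f M)%:E)%E.
  apply/esym; apply: (integral_distribution (X := O) (f := EFin \o f)).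
    exact/measurable_EFinP.
  by apply: int_f; exact: measurable_funP.
have intf : mu.-integrable setT (EFin \o f) by exact: (int_f _ _ mu id).
rewrite (negligible_integral (measurableC mD) measurableT intf mu0).
rewrite setDE setCK setTI -(fineK (integrable_fin_num mD _)); last first.
  exact: integrableS intf.
congr (_%:E); transitivity (p%:R^-1 * \sum_(k < p) bessel_series d (sqnorm (x - y))).
  rewrite -[LHS]/(Rintegral mu (@orthogonal_group R d) f) /f.
  rewrite RintegralZl//; last exact: (haar_bounded_integrable d mu _ bsum).
  congr (_ * _).
  rewrite (haar_Rintegral_sum _ _ haar_mu _ (index_enum 'I_p)
    (fun k M => cos (dot_col (c k) (x - y) M))) => [|k].
    by apply: eq_bigr => k _; exact: haar_Rintegral_cos.
  exact: haar_bounded_cos.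
by rewrite sumr_const card_ord -[X in _ * X]mulr_natl mulrA mulVf ?mul1r// pnatr_eq0 -lt0n.
Qed.

Theorem proposition3 (R : realType) (p d : nat) (hp : (2 <= p)%N)
    (hpd : (p <= d)%N)
    (disp : measure_display) (Omega : measurableType disp)
    (P : probability Omega R)
    (O : {RV P >-> borel_matrix R d})
    (hO : is_haar_orthogonal (distribution P O))
    (c : 'I_p -> 'I_d) (hc : injective c) :
  (forall x y : 'cV[R]_d,
     euclid_norm (x - y) \in `[0, max_radius R d] ->
     ((expR (- (euclid_norm (x - y) ^+ 2 / 2)))%:E
        <= 'E_P[fun w => orf_kernel (colsub c (O w : 'M[R]_d)) x y])%E /\
     ('E_P[fun w => orf_kernel (colsub c (O w : 'M[R]_d)) x y]
        <= (expR (- (euclid_norm (x - y) ^+ 2 / (2 * d%:R))))%:E)%E) /\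
  (forall s : R, is_second_positive_zero (bessel_j d) s ->
   forall x y : 'cV[R]_d,
     euclid_norm (x - y) <= s ->
     ('E_P[fun w => orf_kernel (colsub c (O w : 'M[R]_d)) x y]
        <= (expR (- (euclid_norm (x - y) ^+ 2 / (2 * d%:R))))%:E)%E).
Proof.
have d2 : (2 <= d)%N by exact: leq_trans hpd.
have d0 : (0 < d)%N by exact: ltnW.
have ExpE (x y : 'cV[R]_d) :
    ('E_P[fun w => orf_kernel (colsub c (O w : 'M[R]_d)) x y] =
    (bessel_series d (euclid_norm (x - y) ^+ 2))%:E)%E.
  by rewrite sqr_euclid_norm expectation_orf_kernel// ltnW.
split=> [x y|s [s0 js [r [/andP[r0 rs] jr] jz]] x y xs]; rewrite ExpE !lee_fin.
  rewrite in_itv/= => /(max_radius_sqr _ _ d2) [r [r0 r_le dr /andP[z0 zr]]].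
  (* The lower bound is proved on the whole of [0, z^2]: besides its value at the endpoint, it
     supplies the nonnegativity of F that the upper bound requires. *)
  have ge_exp t : 0 <= t <= euclid_norm (x - y) ^+ 2 ->
      expR (- (t / 2)) <= bessel_series d t.
    move=> /andP[t0 tz]; apply: (bessel_series_ge_expR d d0 r) => //.
    by rewrite t0 (le_trans tz).
  have zz : 0 <= euclid_norm (x - y) ^+ 2 <= euclid_norm (x - y) ^+ 2.
    by rewrite sqr_ge0 lexx.
  split; first exact: ge_exp.
  apply: bessel_series_le_expR zz => // t /andP[t0 tz].
  by apply: le_trans (ge_exp t _); rewrite ?expR_ge0// !ltW.
have z0 : 0 <= euclid_norm (x - y) by exact: sqrtr_ge0.
(* Since j_{d/2-1}(z) = F(z^2), the positive zeros r and s of j_{d/2-1} become the zeros r^2 and s^2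
   of F. *)
apply: (bessel_series_le_expR_second_zero d d0 (r ^+ 2) (s ^+ 2)).
- by rewrite exprn_gt0// ltrXn2r// ?nnegrE ltW.
- by rewrite -bessel_jE.
- by rewrite -bessel_jE.
- move=> t /andP[t0 ts] jt; have t0' := ltW t0.
  rewrite -(sqr_sqrtr t0'); congr (_ ^+ 2); apply: jz.
    by rewrite sqrtr_gt0 t0/= -ltr_sqr ?nnegrE ?sqrtr_ge0 ?(ltW s0)// sqr_sqrtr.
  by rewrite bessel_jE// sqr_sqrtr.
- by rewrite sqr_ge0 ler_sqr ?nnegrE// ltW.
Qed.
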